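(* Let $G$ be an amenable group, $\mathcal{F} = (F_j)_{j \in J}$ a right F\o lner net for $G$, and $V$ a finite-dimensional vector space over a field $\mathbb{K}$. Let $X \subset V^G$ be a nonzero strongly irreducible linear subshift. Then one has $\operatorname{mdim}_{\mathcal{F}}(X) > 0$.
   Context: $V^G$ is the set of all maps (configurations) $x \colon G \to V$, with its product $\mathbb{K}$-vector space structure, the prodiscrete topology (product of the discrete topologies on the factors $V$), and the left $G$-action $(gx)(h) = x(g^{-1}h)$. A linear subshift is a closed $G$-invariant vector subspace of $V^G$. Strong irreducibility: for a finite subset $\Delta \subset G$, a subshift $X$ is $\Delta$-irreducible if, whenever $\Omega_1,\Omega_2$ are finite subsets of $G$ such that there is no $g \in \Omega_2$ with $g\Delta \cap \Omega_1 \neq \varnothing$, then for all $x_1,x_2 \in X$ there is $x \in X$ with $x\vert_{\Omega_1} = x_1\vert_{\Omega_1}$ and $x\vert_{\Omega_2} = x_2\vert_{\Omega_2}$. $X$ is strongly irreducible if it is $\Delta$-irreducible for some finite $\Delta \subset G$. For $E,\Omega \subset G$, $\Omega^{+E} = \{g \in G : gE \cap \Omega \neq \varnothing\} = \Omega E^{-1}$. A right F\o lner net for $G$ is a net $(F_j)_{j\in J}$ (indexed by a directed set $J$) of nonempty finite subsets of $G$ such that $\lim_j |F_j^{+E} \setminus F_j|/|F_j| = 0$ for every finite $E \subset G$. For $\Omega \subset G$, $\pi_\Omega \colon V^G \to V^\Omega$ is the restriction (projection) map. The mean dimension of a vector subspace $X \subset V^G$ with respect to $\mathcal{F}$ is $\operatorname{mdim}_{\mathcal{F}}(X)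 = \limsup_j \dim(\pi_{F_j}(X))/|F_j|$. *)

(* Defs.v *)
From HB Require Import structures.
From mathcomp Require Import all_boot all_order all_algebra finmap.
From mathcomp Require Import all_classical all_reals all_analysis.

Set Implicit Arguments.
Unset Strict Implicit.
Unset Printing Implicit Defensive.

Import Order.TTheory GRing.Theory Num.Theory.
Import numFieldNormedType.Exports.

Local Open Scope classical_set_scope.
Local Open Scope ring_scope.

(* Amenability in the sense of von Neumann: a left-invariant finitely additive
   probability measure defined on all subsets of G. *)
Definition amenable (R : realType) (G : groupType) : Prop :=
  exists mu : set G -> R,
    [/\ forall A, 0 <= mu A,
        mu setT = 1,
        forall A B, A `&` B = set0 -> mu (A `|` B) = mu A + mu B &
        forall g A, mu [set (g * a)%g | a in A] = mu A].

Definition directed_set (d : Order.disp_t) (J : preorderType d) : Prop :=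
  inhabited J /\ forall i j : J, exists k : J, (i <= k)%O /\ (j <= k)%O.

(* The filter of eventual sets along J: limits and limits superior of nets
   indexed by J are taken along it. *)
Definition eventually_along (d : Order.disp_t) (J : preorderType d) :
  set_system J := filter_from setT (fun i : J => [set j | (i <= j)%O]).
Arguments eventually_along {d} J.

(* The set Omega E^-1; see [dilationP]. *)
Definition dilation (G : groupType) (Omega E : {fset G}) : {fset G} :=
  [fset (h * e^-1)%g | h in Omega, e in E]%fset.

Lemma dilationP (G : groupType) (Omega E : {fset G}) (g : G) :
  g \in dilation Omega E <-> exists2 e, e \in E & (g * e)%g \in Omega.
Proof.
split=> [/imfset2P[/= h hO [e eE ->]]|[e eE geO]].
  by exists e; rewrite // -mulgA mulVg mulg1.
apply/imfset2P; exists (g * e)%g => //; exists e => //.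
by rewrite -mulgA mulgV mulg1.
Qed.

Definition right_Folner_net (R : realType) (G : groupType)
    (d : Order.disp_t) (J : preorderType d) (F : J -> {fset G}) : Prop :=
  [/\ directed_set J,
      forall j, F j != fset0 &
      forall E : {fset G},
        (#|` (dilation (F j) E `\` F j)%fset|%:R / #|` F j|%:R : R)
          @[j --> eventually_along J] --> (0 : R)].

Section Configurations.
Variables (G : groupType) (K : fieldType) (V : vectType K).
Implicit Types (X : set (G -> V)) (x : G -> V).

(* G -> V with the product of the discrete topologies on the factors. *)
Definition prodiscrete : topologicalType :=
  prod_topology (fun _ : G => discrete_topology V).

Definition translate (g : G) x : G -> V := fun h => x (g^-1 * h)%g.

Record linear_subshift X : Prop := LinearSubshift {
  linear_subshift_subspace : submod_closed [in X] ;
  linear_subshift_closed : closed (X : set prodiscrete) ;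
  linear_subshift_invariant : forall g x, X x -> X (translate g x) }.

Definition irreducible_for (Delta : {fset G}) X : Prop :=
  forall Omega1 Omega2 : {fset G},
    ~ (exists2 g, g \in Omega2 &
         exists2 e, e \in Delta & (g * e)%g \in Omega1) ->
    forall x1 x2, X x1 -> X x2 ->
    exists x, [/\ X x, {in Omega1, x =1 x1} & {in Omega2, x =1 x2}].

Definition strongly_irreducible X : Prop :=
  exists Delta : {fset G}, irreducible_for Delta X.

Definition restriction (Omega : {fset G}) x : {ffun Omega -> V} :=
  [ffun h : Omega => x (val h)].

End Configurations.

(* The subspace with underlying set S, when there is one (junk value 0
   otherwise); see [mem_vspace_of]. *)
Definition vspace_of (K : fieldType) (W : vectType K) (S : set W) :
  {vspace W} := xget 0%VS [set U : {vspace W} | [set w | w \in U] = S].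

Lemma mem_vspace_of (K : fieldType) (W : vectType K) (S : set W) :
  submod_closed [in S] -> [set w | w \in vspace_of S] = S.
Proof.
move=> [S0 Slin].
pose P n := `[< exists U : {vspace W},
  [set w | w \in U] `<=` S /\ \dim U = n >].
have Pex : exists n, P n.
  exists 0%N; apply/asboolP; exists 0%VS; split; last exact: dimv0.
  by move=> w /=; rewrite memv0 => /eqP ->; move: S0; rewrite inE.
have Pub n : P n -> (n <= \dim {:W})%N.
  by move=> /asboolP[U [_ <-]]; rewrite dimvS// subvf.
case: (ex_maxnP Pex Pub) => n /asboolP[U [US Un]] nmax.
rewrite /vspace_of; case: xgetP => [_ _ //|]; case/(_ U).
apply/seteqP; split=> // w Sw /=; apply: contraT => wU.
have : P (\dim (U + <[w]>)).
  apply/asboolP; exists (U + <[w]>)%VS; split=> // v /memv_addP[u uU].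
  move=> [_ /vlineP[k ->] ->] {v}.
  suff : k *: w + u \in S by rewrite inE addrC.
  by apply: Slin; rewrite inE//; exact: US.
move=> /nmax; rewrite leqNgt => /negP; case.
rewrite -Un ltnNge; apply/negP => le_dim.
have /eqP UE : U == (U + <[w]>)%VS by rewrite eqEdim addvSl le_dim.
by move: wU; rewrite memvE UE addvSr.
Qed.

Section MeanDimension.
Variables (R : realType) (G : groupType) (K : fieldType) (V : vectType K).

Lemma submod_closed_restriction (X : set (G -> V)) (Omega : {fset G}) :
  submod_closed [in X] -> submod_closed [in @restriction G K V Omega @` X].
Proof.
move=> [X0 Xlin]; split.
  by apply/mem_set; exists 0; [exact: set_mem|apply/ffunP => h; rewrite !ffunE].
move=> a _ _ /set_mem[x Xx <-] /set_mem[y Xy <-]; apply/mem_set.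
exists (a *: x + y); last by apply/ffunP => h; rewrite !ffunE.
by apply/set_mem/Xlin; apply/mem_set.
Qed.

(* [limf_esup] asks for a filtered type; the discrete structure put on J here
   is irrelevant, the limit superior only depends on the filter. *)
Definition mdim (d : Order.disp_t) (J : preorderType d) (F : J -> {fset G})
    (X : set (G -> V)) : \bar R :=
  limf_esup (X := discrete_topology J)
    (fun j => ((\dim (vspace_of (@restriction G K V (F j) @` X)))%:R
               / #|` F j|%:R)%:E)
    (eventually_along J).

End MeanDimension.

(* Main.v *)
Require Import Defs.
From mathcomp Require Import all_boot all_order all_algebra finmap.
From mathcomp Require Import all_classical all_reals all_analysis.

(** A nonzero linear subshift has, by translation, a configuration which does
    not vanish at any prescribed element of [G]. Let [D] be a finite symmetric
    subset containing [1] and a set for which [X] is irreducible. A maximal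
    [D]-separated subset [S] of a finite set [Omega] satisfies
    [Omega \subset S D], so [#|S| >= #|Omega| / #|D|]
    ([exists_separated_cover]). Strong irreducibility supplies for each [s]
    in [S] a configuration of [X] which is nonzero at [s] and zero on the rest
    of [S] ([exists_isolated_configuration]); the restrictions to [Omega] of
    these configurations are linearly independent ([leq_dim_of_dual_points]).
    Hence [dim (pi_Omega X) >= #|Omega| / #|D|] for every finite [Omega], and
    the mean dimension is at least [1 / #|D|]. *)

Set Implicit Arguments.
Unset Strict Implicit.
Unset Printing Implicit Defensive.

Import Order.TTheory GRing.Theory Num.Theory.

Local Open Scope classical_set_scope.
Local Open Scope ring_scope.

Definition separated (G : groupType) (D S : {fset G}) : Prop :=
  {in S &, forall s t, s != t -> (s^-1 * t)%g \notin D}.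

(** Greedy construction: an element [a] of [Omega] is added to [S] unless
    [s^-1 * a \in D] for some [s] already in [S]; either way [a] ends up in
    [S D], whence the cardinality bound. Symmetry of [D] lets one test
    closeness in one direction only. *)
Lemma exists_separated_cover (G : groupType) (D Omega : {fset G}) :
  1%g \in D -> {in D, forall e, e^-1%g \in D} ->
  exists S : {fset G},
    [/\ {subset S <= Omega}, separated D S & (#|` Omega| <= #|` S| * #|` D|)%N].
Proof.
move=> D1 DV.
suff [S [SO sepS cov]] : exists S : {fset G}, [/\ {subset S <= Omega},
    separated D S &
    {in Omega, forall f, exists2 s, s \in S & (s^-1 * f)%g \in D}].
  exists S; split=> //.
  rewrite -(size_allpairs (fun s e => s * e)%g).
  apply: uniq_leq_size (fset_uniq _) _ => f /cov[s sS sfD].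
  by apply/allpairsP; exists (s, (s^-1 * f)%g); rewrite mulgA mulgV mul1g.
elim/finSet_rect: Omega => Omega IH.
have [->|[a aO]] := fset_0Vmem Omega.
  by exists fset0; split=> // ?; rewrite inE.
have [S [SO sepS cov]] := IH _ (fproperD1 aO).
have SOmega : {subset S <= Omega} by move=> s /SO; rewrite !inE => /andP[].
have [[s sS saD]|far] := pselect (exists2 s, s \in S & (s^-1 * a)%g \in D).
  exists S; split=> // f fO; have [->|fa] := eqVneq f a; first by exists s.
  by apply: cov; rewrite !inE fa.
exists (a |` S)%fset; split.
- by move=> s; rewrite !inE => /orP[/eqP->//|/SOmega].
- move=> s t; rewrite !inE => /orP[/eqP->|sS] /orP[/eqP->|tS] st.
  + by rewrite eqxx in st.
  + apply/negP => /DV; rewrite invgM invgK => taD.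
    by apply: far; exists t.
  + by apply/negP => saD; apply: far; exists s.
  + exact: sepS.
- move=> f fO; have [->|fa] := eqVneq f a.
    by exists a; rewrite ?inE ?eqxx // mulVg.
  have [|s sS sfD] := cov f; first by rewrite !inE fa.
  by exists s; rewrite // !inE sS orbT.
Qed.

(** Evaluating a linear relation between the [w i] at the point [p i]
    kills all its terms except the [i]-th one. *)
Lemma leq_dim_of_dual_points (K : fieldType) (V : vectType K) (A I : finType)
    (U : {vspace {ffun A -> V}}) (w : I -> {ffun A -> V}) (p : I -> A) :
  (forall i, w i \in U) -> (forall i, w i (p i) != 0) ->
  (forall i j, i != j -> w i (p j) = 0) -> (#|I| <= \dim U)%N.
Proof.
move=> wU wp wp0; pose ws := [tuple w (enum_val i) | i < #|I|].
have free_ws : free ws.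
  apply/freeP => k k0 i.
  move/ffunP: k0 => /(_ (p (enum_val i))).
  rewrite sum_ffunE !ffunE (bigD1 i)//=.
  rewrite big1 ?addr0 => [|j ji];
    rewrite (nth_mktuple (fun i => w (enum_val i))) ffunE.
    by move/eqP; rewrite scaler_eq0 (negPf (wp _)) orbF => /eqP.
  by rewrite wp0 ?scaler0// (inj_eq enum_val_inj).
have := free_ws; rewrite /free size_tuple => /eqP <-; apply: dimvS.
by apply/span_subvP => _ /mapP[i _ ->].
Qed.

Section Subshift.
Variables (G : groupType) (K : fieldType) (V : vectType K) (X : set (G -> V)).
Hypothesis subX : linear_subshift X.

Lemma exists_nonzero_at (g : G) : X <> [set 0] -> exists2 x, X x & x g != 0.
Proof.
move=> Xn0; apply: contrapT => no; apply: Xn0.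
have [X0 _] := linear_subshift_subspace subX.
apply/seteqP; split=> [x Xx /=|_ ->]; last exact: set_mem.
apply/funext => h; apply: contrapT => /eqP xh; apply: no.
exists (translate (g * h^-1)%g x).
  exact: linear_subshift_invariant.
by rewrite /translate invgM invgK -mulgA mulVg mulg1.
Qed.

(** [D]-separation of [S] is what allows irreducibility to be applied to
    [[fset s]] and [S `\ s], with a configuration nonzero at [s] on the former
    and the zero configuration on the latter. *)
Lemma exists_isolated_configuration (Delta D S : {fset G}) (s : G) :
  X <> [set 0] -> irreducible_for Delta X -> {subset Delta <= D} ->
  separated D S -> s \in S ->
  exists x, [/\ X x, x s != 0 & {in S, forall t, t != s -> x t = 0}].
Proof.
move=> Xn0 irrX DeltaD sepS sS.
have [x1 Xx1 x1s] := exists_nonzero_at s Xn0.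
have [X0 _] := linear_subshift_subspace subX.
have [||x [Xx xs xS]] := irrX [fset s]%fset (S `\ s)%fset _ x1 0 Xx1.
- case=> g; rewrite !inE => /andP[gs gS] [e eD]; rewrite inE => /eqP ges.
  have := sepS _ _ gS sS gs.
  by rewrite -ges mulgA mulVg mul1g DeltaD.
- exact: set_mem.
exists x; split=> // [|t tS ts]; first by rewrite xs ?inE.
by rewrite xS // !inE ts.
Qed.

Lemma leq_card_dim_restriction (Delta D Omega : {fset G}) :
  X <> [set 0] -> irreducible_for Delta X -> {subset Delta <= D} ->
  1%g \in D -> {in D, forall e, e^-1%g \in D} ->
  (#|` Omega| <=
     \dim (vspace_of (@restriction G K V Omega @` X)) * #|` D|)%N.
Proof.
move=> Xn0 irrX DeltaD D1 DV.
have [S [SO sepS card_le]] := exists_separated_cover Omega D1 DV.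
apply: leq_trans card_le _; rewrite leq_mul2r; apply/orP; right.
have isolated (s : S) : exists x,
    [/\ X x, x (val s) != 0 & {in S, forall t, t != val s -> x t = 0}].
  exact: (exists_isolated_configuration Xn0 irrX DeltaD sepS (valP s)).
have [x xP] := choice isolated.
rewrite cardfE.
apply: (@leq_dim_of_dual_points _ _ _ _ _ (fun s => restriction Omega (x s))
  (fun s => FSetSub (SO _ (valP s)))).
- move=> s; have [Xx _ _] := xP s.
  have /seteqP[_ sub] := mem_vspace_of
    (submod_closed_restriction Omega (linear_subshift_subspace subX)).
  by apply: sub; exists (x s).
- by move=> s; have [_ xs _] := xP s; rewrite ffunE.
- move=> s t st; have [_ _ xS] := xP s; rewrite ffunE /=.
  by apply: xS; [exact: valP|rewrite eq_sym].
Qed.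

End Subshift.

(** A bound valid at every index passes to the limit superior because a
    filter generated by the tails of a nonempty index set is generated by
    nonempty sets. *)
Lemma mdim_ge (R : realType) (G : groupType) (K : fieldType) (V : vectType K)
    (d : Order.disp_t) (J : preorderType d) (F : J -> {fset G})
    (X : set (G -> V)) (c : \bar R) :
  (forall j, c <= ((\dim (vspace_of (@restriction G K V (F j) @` X)))%:R
                   / #|` F j|%:R)%:E)%E ->
  (c <= mdim R F X)%E.
Proof.
move=> cF; apply: le_ereal_inf_tmp => _ [A [i _ iA] <-].
apply: le_trans (cF i) _; apply: ereal_sup_ubound.
by exists i => //; apply: iA => /=.
Qed.

Theorem corollary3p3 (R : realType) (G : groupType)
  (d : Order.disp_t) (J : preorderType d) (F : J -> {fset G})
  (K : fieldType) (V : vectType K) (X : set (G -> V)) :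
  amenable R G ->
  right_Folner_net R F ->
  linear_subshift X ->
  X <> [set 0%R]%classic ->
  strongly_irreducible X ->
  (0 < mdim R F X)%E.
Proof.
move=> _ [_ F0 _] subX Xn0 [Delta irrX].
pose D := (1%g |` (Delta `|` [fset e^-1%g | e in Delta]))%fset.
have D1 : 1%g \in D by rewrite !inE eqxx.
have DeltaD : {subset Delta <= D} by move=> e; rewrite !inE => ->; rewrite orbT.
have DV : {in D, forall e, e^-1%g \in D}.
  move=> e; rewrite !inE => /or3P[/eqP->|eD|/imfsetP[f /= fD ->]].
  - by rewrite invg1 eqxx.
  - by apply/or3P/Or33/imfsetP; exists e.
  - by rewrite invgK fD orbT.
have Dgt0 : 0 < #|` D|%:R :> R.
  by rewrite ltr0n cardfs_gt0; apply/fset0Pn; exists 1%g.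
apply: (@lt_le_trans _ _ (#|` D|%:R^-1 : R)%:E); first by rewrite lte_fin invr_gt0.
apply: mdim_ge => j; rewrite lee_fin.
have Fgt0 : 0 < #|` F j|%:R :> R by rewrite ltr0n cardfs_gt0.
rewrite ler_pdivlMr // mulrC ler_pdivrMr // -natrM ler_nat.
exact: (leq_card_dim_restriction subX _ Xn0 irrX DeltaD D1 DV).
Qed.
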